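(* Let $\vdash$ be an algebraizable logic with equivalent algebraic semantics the quasivariety $\mathbf{Y}$, and let $f$ be a selector term. Every $\mathsf{PAt}$-$f$-logic $\vdash_s$ (relative to $\vdash$) is complete with respect to its corresponding $\mathsf{PAt}$-$f$-quasivariety, i.e. for every pair $(\Gamma,\phi)$ with $\Gamma\cup\{\phi\}\subseteq Tm(\mathcal{L},\mathsf{Prop})$: $$\Gamma\vdash_s\phi \iff \mathsf{QVar}^f(\vdash_s)\vDash_f(\Gamma,\phi).$$
   Context: Let $\mathcal{L}$ be an algebraic language (function symbols with arities), $\mathsf{Prop}$ a fixed countably infinite set of variables, $Tm(\mathcal{L},\mathsf{Prop})$ the set of terms (also called formulas). A consequence relation on a set $C$ is a relation between subsets of $C$ and elements of $C$ that is reflexive ($W\vdash a$ if $a\in W$) and satisfies cut (if $W\vdash v$ for all $v\in V$ and $V\vdash a$ then $W\vdash a$); all consequence relations are assumed finitary (if $W\vdash a$ then $V\vdash a$ for some finite $V\subseteq W$). A logic is a consequence relation on $Tm(\mathcal{L},\mathsf{Prop})$ that is invariant under substitutions (endomorphisms of the term algebra). $\Lambda(\vdash)$ is the complete lattice of (finitary) logics extending $\vdash$. A quasivariety is a class of algebras closed under isomorphisms, subalgebras and reduced products. For a class $\mathbf{K}$, $\Theta\vDash_{\mathbf{K}}\gamma\approx\delta$ means that every assignment into an algebra of $\mathbf{K}$ satisfying all equations in $\Theta$ satisfies $\gamma\approx\delta$. The logic $\vdash$ is algebraizable with equivalent algebraic semantics the quasivariety $\mathbf{Y}$ (of language $\mathcal{L}$),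 witnessed by a finite set $\mu(x)$ of equations in one variable and a finite set $\Delta(x,y)$ of formulas in two variables: (1) $\Gamma\vdash\phi$ iff $\mu[\Gamma]\vDash_{\mathbf{Y}}\mu(\phi)$; (2) $\Theta\vDash_{\mathbf{Y}}\gamma\approx\delta$ iff $\Delta[\Theta]\vdash\Delta(\gamma,\delta)$; (3) $\phi\dashv\vdash\Delta[\mu(\phi)]$; (4) $\gamma\approx\delta$ and $\mu[\Delta(\gamma,\delta)]$ are $\vDash_{\mathbf{Y}}$-interderivable. Here $\mu[\Gamma]$ is the union of the sets $\mu(\psi)$ for $\psi\in\Gamma$, and $\Delta[\Theta]$ is the union of the sets $\Delta(\varepsilon,\upsilon)$ for $\varepsilon\approx\upsilon$ in $\Theta$. A unary term $f(x)$ of $\mathcal{L}$ is a selector term if it is idempotent, i.e. $f(f(x))\dashv\vdash f(x)$ (each of $f(f(x))$ and $f(x)$ is derivable from the other in $\vdash$). For a formula $\chi$, $\chi[f(\overline p)/\overline p]$ is the result of substituting $f(q)$ for each variable $q$ in $\chi$; $\Gamma[f(\overline p)/\overline p]$ is defined elementwise. For $\vdash_*\in\Lambda(\vdash)$ its $\mathsf{PAt}$-$f$-variant $\vdash_*^f$ is defined by $\Gamma\vdash_*^f\phi$ iff $\Gamma[f(\overline p)/\overline p]\vdash_*\phi[f(\overline p)/\overline p]$. A $\mathsf{PAt}$-$f$-logic is a relation of the form $\vdash_*^f$ with $\vdash_*\in\Lambda(\vdash)$. For $\mathcal{A}\in\mathbf{Y}$, $\mathcal{A}^f=\{a\in A: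 f(a)=a\}$ is the set of regular elements. A polyatomic model is a pair $(\mathcal{A},v)$ with $v:\mathsf{Prop}\to\mathcal{A}^f$. $\mathcal{A},v\vDash(\Gamma,\phi)$ means: if $\mathcal{A},v\vDash\mu[\Gamma]$ then $\mathcal{A},v\vDash\mu(\phi)$. $\mathcal{A}\vDash_f(\Gamma,\phi)$ means $\mathcal{A},v\vDash(\Gamma,\phi)$ for all polyatomic models $(\mathcal{A},v)$ on $\mathcal{A}$; $\mathbf{K}\vDash_f(\Gamma,\phi)$ means $\mathcal{A}\vDash_f(\Gamma,\phi)$ for all $\mathcal{A}\in\mathbf{K}$. The $\mathsf{PAt}$-$f$-quasivariety corresponding to $\vdash_s$ is $\mathsf{QVar}^f(\vdash_s)=\{\mathcal{A}\in\mathbf{Y}:\mathcal{A}\vDash_f(\Gamma,\phi)\text{ for all }(\Gamma,\phi)\in{\vdash_s}\}$.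
   Formalization: A selector term is required to satisfy f(f(a)) = f(a) in every algebra of Y, besides f(f(x)) ⊣⊢ f(x); with interderivability alone the claim fails (global consequence of modal logic T, f = box, and the pair (∅, p → box p)). *)

(* Defs.v *)
From mathcomp Require Import all_boot.
From mathcomp Require Import all_classical.

Set Implicit Arguments.
Unset Strict Implicit.
Unset Printing Implicit Defensive.

Local Open Scope classical_set_scope.

(** * Terms and algebras *)

Record language := Language {
  symbol :> Type;
  arity : symbol -> nat
}.

Inductive term (L : language) (X : Type) : Type :=
| Var of X
| App (s : L) of ('I_(arity s) -> term L X).
Arguments Var {L X}.
Arguments App {L X}.

Fixpoint subst (L : language) (X Y : Type) (sigma : X -> term L Y)
    (t : term L X) : term L Y :=
  match t with
  | Var x => sigma x
  | App s args => App s (fun i => subst sigma (args i))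
  end.

Definition Prop_var := nat.

Notation formula L := (term L Prop_var).

(* A unary term is a term over a one-element set of variables, and a binary
   term t(x, y) one over [bool], with x = Var false and y = Var true. *)
Definition inst1 (L : language) (X : Type) (t : term L unit) (u : term L X) :
  term L X := subst (fun=> u) t.

Definition inst2 (L : language) (X : Type) (t : term L bool)
  (u w : term L X) : term L X := subst (fun b => if b then w else u) t.

Record algebra (L : language) := Algebra {
  carrier :> Type;
  op : forall s : L, ('I_(arity s) -> carrier) -> carrier;
  carrier_inhabited : inhabited carrier
}.
Arguments op {L} a s _.

Fixpoint eval (L : language) (A : algebra L) (X : Type) (v : X -> A)
    (t : term L X) : A :=
  match t with
  | Var x => v x
  | App s args => op A s (fun i => eval v (args i))
  end.

Definition eval1 (L : language) (A : algebra L) (t : term L unit) (a : A) : A :=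
  eval (fun=> a) t.

(** * Quasivarieties *)

Definition is_hom (L : language) (A B : algebra L) (h : A -> B) : Prop :=
  forall (s : L) (args : 'I_(arity s) -> A),
    h (op A s args) = op B s (fun i => h (args i)).

Definition isomorphic (L : language) (A B : algebra L) : Prop :=
  exists h : A -> B, is_hom h /\ bijective h.

Definition op_closed (L : language) (A : algebra L) (S : A -> Prop) : Prop :=
  forall (s : L) (args : 'I_(arity s) -> A),
    (forall i, S (args i)) -> S (op A s args).

Lemma subcarrier_inhabited (L : language) (A : algebra L) (S : A -> Prop) :
  (exists a, S a) -> inhabited {a : A | S a}.
Proof. by case=> a Sa; exact: (inhabits (exist _ a Sa)). Qed.

Definition subalgebra (L : language) (A : algebra L) (S : A -> Prop)
    (S_closed : op_closed S) (S_neq0 : exists a, S a) : algebra L :=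
  @Algebra L {a : A | S a}
    (fun s args => exist S (op A s (fun i => sval (args i)))
                     (S_closed s _ (fun i => svalP (args i))))
    (subcarrier_inhabited S_neq0).

Section ReducedProduct.
Variables (L : language) (I : Type) (A : I -> algebra L) (F : set_system I).

Definition redprod_rel (a b : forall i, A i) : Prop := F [set i | a i = b i].

Definition redprod_carrier : Type :=
  {C : (forall i, A i) -> Prop | exists a, C = redprod_rel a}.

Definition redprod_class (a : forall i, A i) : redprod_carrier :=
  exist _ (redprod_rel a) (ex_intro _ a erefl).

Definition redprod_repr (c : redprod_carrier) : forall i, A i :=
  sval (cid (svalP c)).

Definition redprod_op (s : L) (args : 'I_(arity s) -> redprod_carrier) :
    redprod_carrier :=
  redprod_class (fun i => op (A i) s (fun k => redprod_repr (args k) i)).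

Lemma redprod_inhabited : inhabited redprod_carrier.
Proof.
have ne i : exists _ : A i, True by case: (carrier_inhabited (A i)) => a; exists a.
exact: (inhabits (redprod_class (fun i => sval (cid (ne i))))).
Qed.

Definition reduced_product : algebra L :=
  @Algebra L redprod_carrier redprod_op redprod_inhabited.

(* When F is a filter, the operations do not depend on the representatives
   chosen in [redprod_op]. *)
Lemma redprod_classP (a b : forall i, A i) : Filter F ->
  redprod_class a = redprod_class b <-> F [set i | a i = b i].
Proof.
move=> FF; split=> [/(congr1 sval) /= e|Fab].
  have : redprod_rel b b.
    by apply: filterS (@filterT _ _ FF) => i _.
  by rewrite -e.
apply: eq_exist; apply/funext => c; apply/propext; split=> Fc.
- by apply: filterS2 Fab Fc => i /= ->.
- by apply: filterS2 Fab Fc => i /= ->.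
Qed.

Lemma redprod_opE (s : L) (args : 'I_(arity s) -> forall i, A i) : Filter F ->
  redprod_op (fun k => redprod_class (args k)) =
  redprod_class (fun i => op (A i) s (fun k => args k i)).
Proof.
move=> FF; apply: (redprod_classP _ _ _).2.
have Frepr k : F [set i | redprod_repr (redprod_class (args k)) i = args k i].
  rewrite /redprod_repr; case: cid => a /= /esym ea.
  by apply/redprod_classP; exact: eq_exist.
have := filter_forall FF Frepr; apply: filterS => i /= e.
by congr (op _ _ _); apply/funext.
Qed.

End ReducedProduct.

Record quasivariety (L : language) (K : algebra L -> Prop) : Prop := {
  quasivariety_iso : forall A B : algebra L, isomorphic A B -> K A -> K B;
  quasivariety_sub : forall (A : algebra L) (S : A -> Prop)
    (S_closed : op_closed S) (S_neq0 : exists a, S a),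
    K A -> K (subalgebra S_closed S_neq0);
  (* As usual, the empty family and the improper filter are allowed, so that
     a quasivariety contains the one-element algebras. *)
  quasivariety_redprod : forall (I : Type) (A : I -> algebra L)
    (F : set_system I), Filter F ->
    (forall i, K (A i)) -> K (reduced_product A F)
}.

(** * Equations *)

Definition equation (L : language) (X : Type) : Type := (term L X * term L X)%type.

Definition sat_eq (L : language) (X : Type) (A : algebra L) (v : X -> A)
    (e : equation L X) : Prop :=
  eval v e.1 = eval v e.2.

Definition sat_eqs (L : language) (X : Type) (A : algebra L) (v : X -> A)
    (Theta : set (equation L X)) : Prop :=
  forall e, Theta e -> sat_eq v e.

Definition eq_conseq (L : language) (K : algebra L -> Prop)
    (Theta : set (equation L Prop_var)) (e : equation L Prop_var) : Prop :=
  forall A : algebra L, K A ->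
    forall v : Prop_var -> A, sat_eqs v Theta -> sat_eq v e.

(** * Logics *)

Record consequence_relation (C : Type) (R : set C -> C -> Prop) : Prop := {
  conseq_refl : forall (W : set C) (a : C), W a -> R W a;
  conseq_cut : forall (W V : set C) (a : C),
    (forall v, V v -> R W v) -> R V a -> R W a;
  conseq_finitary : forall (W : set C) (a : C),
    R W a -> exists V : set C, [/\ V `<=` W, finite_set V & R V a]
}.

Notation entailment L := (set (formula L) -> formula L -> Prop).

Record logic (L : language) (der : entailment L) : Prop := {
  logic_conseq : consequence_relation der;
  logic_subst : forall (sigma : Prop_var -> formula L) (Gamma : set (formula L))
    (phi : formula L),
    der Gamma phi -> der (subst sigma @` Gamma) (subst sigma phi)
}.

Definition interderivable (L : language) (der : entailment L)
    (phi psi : formula L) : Prop :=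
  der [set phi] psi /\ der [set psi] phi.

(* Membership in Lambda(der). *)
Definition extension (L : language) (der der' : entailment L) : Prop :=
  logic der' /\ forall Gamma phi, der Gamma phi -> der' Gamma phi.

(** * Algebraizability *)

Section Algebraizable.
Variables (L : language).
Variables (mu : set (equation L unit)) (Delta : set (term L bool)).

Definition mu_form (phi : formula L) : set (equation L Prop_var) :=
  [set (inst1 e.1 phi, inst1 e.2 phi) | e in mu].

Definition mu_set (Gamma : set (formula L)) : set (equation L Prop_var) :=
  \bigcup_(psi in Gamma) mu_form psi.

Definition Delta_eq (e : equation L Prop_var) : set (formula L) :=
  [set inst2 t e.1 e.2 | t in Delta].

Definition Delta_set (Theta : set (equation L Prop_var)) : set (formula L) :=
  \bigcup_(e in Theta) Delta_eq e.

Record algebraizable (der : entailment L) (Y : algebra L -> Prop) : Prop := {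
  alg_mu_finite : finite_set mu;
  alg_Delta_finite : finite_set Delta;
  alg_der : forall (Gamma : set (formula L)) (phi : formula L),
    der Gamma phi <->
    forall e, mu_form phi e -> eq_conseq Y (mu_set Gamma) e;
  alg_eq : forall (Theta : set (equation L Prop_var)) (e : equation L Prop_var),
    eq_conseq Y Theta e <->
    forall psi, Delta_eq e psi -> der (Delta_set Theta) psi;
  alg_Delta_mu : forall phi : formula L,
    (forall psi, Delta_set (mu_form phi) psi -> der [set phi] psi) /\
    der (Delta_set (mu_form phi)) phi;
  alg_mu_Delta : forall e : equation L Prop_var,
    (forall e', mu_set (Delta_eq e) e' -> eq_conseq Y [set e] e') /\
    eq_conseq Y (mu_set (Delta_eq e)) e
}.

End Algebraizable.

(** * Polyatomic logics *)

Section Polyatomic.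
Variables (L : language) (f : term L unit).

(* Interderivability of f(f(p)) and f(p) alone does not make f idempotent as an
   operation on Y: for f = box it holds in the global modal logic of reflexive
   frames, where box box p and box p are not equivalent. The completeness
   theorem needs the values of f to be regular elements, so "idempotent" is
   taken to include f(f(a)) = f(a) in the algebras of Y. *)
Definition selector_term (der : entailment L) (Y : algebra L -> Prop) : Prop :=
  (forall p : Prop_var,
     interderivable der (inst1 f (inst1 f (Var p))) (inst1 f (Var p))) /\
  (forall A : algebra L, Y A ->
     forall a : A, eval1 f (eval1 f a) = eval1 f a).

Definition subst_f (chi : formula L) : formula L :=
  subst (fun q => inst1 f (Var q)) chi.

Definition PAt_variant (der : entailment L) : entailment L :=
  fun Gamma phi => der (subst_f @` Gamma) (subst_f phi).

Definition PAt_logic (der der_s : entailment L) : Prop :=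
  exists2 der', extension der der' & der_s = PAt_variant der'.

Definition regular (A : algebra L) : set A := [set a | eval1 f a = a].

Definition polyatomic_model (A : algebra L) (v : Prop_var -> A) : Prop :=
  forall p, regular (v p).

Definition model_sat (mu : set (equation L unit)) (A : algebra L)
    (v : Prop_var -> A) (Gamma : set (formula L)) (phi : formula L) : Prop :=
  sat_eqs v (mu_set mu Gamma) -> sat_eqs v (mu_form mu phi).

Definition alg_sat (mu : set (equation L unit)) (A : algebra L)
    (Gamma : set (formula L)) (phi : formula L) : Prop :=
  forall v : Prop_var -> A, polyatomic_model v -> model_sat mu v Gamma phi.

Definition class_sat (mu : set (equation L unit)) (K : algebra L -> Prop)
    (Gamma : set (formula L)) (phi : formula L) : Prop :=
  forall A : algebra L, K A -> alg_sat mu A Gamma phi.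

Definition QVar (mu : set (equation L unit)) (Y : algebra L -> Prop)
    (der_s : entailment L) (A : algebra L) : Prop :=
  Y A /\ forall Gamma phi, der_s Gamma phi -> alg_sat mu A Gamma phi.

End Polyatomic.

(* Main.v *)
Require Import Defs.
From mathcomp Require Import all_boot.
From mathcomp Require Import all_classical.

(** Soundness holds by the definition of QVar.  For completeness, let der_s be
    the variant of an extension der' of der, write chi^f for [subst_f f chi],
    and let T be the set of der'-consequences of Gamma^f.  Since T is closed
    under der, algebraizability makes
      theta = the set of equations e with Delta(e) included in T
    closed under the consequence of Y ([Delta_theory_closed]), and makes psi
    belong to T exactly when mu(psi) is included in theta ([mu_in_theory]).

    A set theta of equations closed under the consequence of a quasivariety is
    the set of equations true under some assignment v that generates an algebra
    A of the quasivariety ([term_generated_model]): A is the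
    Lindenbaum-Tarski algebra of T.

    It remains to see two things.  First, A is in QVar: since A is generated by
    v, an assignment w of regular elements is the evaluation under v of some
    substitution sigma, and regularity lets one replace w by f o w, so that the
    value of chi under w is the value of sigma(chi^f) under v.  Hence w
    validates mu(chi) exactly when sigma(chi^f) is in T, and a rule of der_s is
    preserved because der' is invariant under sigma.  Second, the assignment
    p |-> f(v p) consists of regular elements, because f is idempotent on Y, and
    validates mu(chi) exactly when chi^f is in T; so it validates mu[Gamma], and
    if it validates mu(phi) then Gamma^f derives phi^f in der'. *)

Set Implicit Arguments.
Unset Strict Implicit.
Unset Printing Implicit Defensive.

Local Open Scope classical_set_scope.

Lemma eval_subst (L : language) (A : algebra L) (X Z : Type)
    (sigma : X -> term L Z) (v : Z -> A) (t : term L X) :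
  eval v (subst sigma t) = eval (fun x => eval v (sigma x)) t.
Proof.
elim: t => [//|s args IH] /=.
by congr (op _ _ _); apply/funext => i; exact: IH.
Qed.

Lemma hom_eval (L : language) (A B : algebra L) (h : A -> B) (X : Type)
    (v : X -> A) (t : term L X) :
  is_hom h -> h (eval v t) = eval (fun x => h (v x)) t.
Proof.
move=> hom_h; elim: t => [//|s args IH] /=.
by rewrite hom_h; congr (op _ _ _); apply/funext => i; exact: IH.
Qed.

Lemma eval_redprod (L : language) (I X : Type) (A : I -> algebra L)
    (F : set_system I) (v : forall i, X -> A i) (t : term L X) : Filter F ->
  eval (fun x => redprod_class F (fun i => v i x) : reduced_product A F) t =
  redprod_class F (fun i => eval (v i) t).
Proof.
move=> FF; elim: t => [//|s args IH] /=.
rewrite -(redprod_opE (fun k i => eval (v i) (args k)) FF).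
by congr redprod_op; apply/funext => k; exact: IH.
Qed.

(** The equations mu(chi) speak about chi only through its value. *)
Lemma sat_mu_form (L : language) (mu : set (equation L unit))
    (C : algebra L) (v : Prop_var -> C) (w : Prop_var -> C)
    (chi psi : formula L) :
  eval w chi = eval v psi ->
  sat_eqs w (mu_form mu chi) <-> sat_eqs v (mu_form mu psi).
Proof.
move=> e; rewrite /sat_eqs /mu_form.
by split=> H _ [d mud <-]; have := H _ (ex_intro2 _ _ d mud erefl);
  rewrite /sat_eq /= /inst1 !eval_subst e.
Qed.

(** Each equation outside Theta fails in some model of Theta in K; a product of
    such models refutes them all at once, and its subalgebra of term values is
    generated by the assignment. *)
Lemma term_generated_model (L : language) (K : algebra L -> Prop)
    (Theta : set (equation L Prop_var)) :
  quasivariety K -> (forall e, eq_conseq K Theta e -> Theta e) ->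
  exists (A : algebra L) (v : Prop_var -> A),
    [/\ K A, forall a : A, exists t, eval v t = a
      & forall e, sat_eq v e <-> Theta e].
Proof.
move=> qK closedTheta.
pose I := {e | ~ Theta e}.
have /choice[M MP] (i : I) : exists m : {B : algebra L & Prop_var -> B},
    [/\ K (projT1 m), sat_eqs (projT2 m) Theta & ~ sat_eq (projT2 m) (sval i)].
  case: i => e /= nThetae; apply: contrapT => noM; apply/nThetae/closedTheta.
  move=> B KB v vTheta; apply: contrapT => nve; apply: noM.
  by exists (existT _ B v).
(* The product of the family is its reduced product by the trivial filter. *)
pose F : set_system I := [set P | forall i, P i].
have FF : Filter F.
  split; first by [].
  - by move=> P Q FP FQ i; split; [exact: FP | exact: FQ].
  - by move=> P Q PQ FP i; apply: PQ; exact: FP.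
pose Pr := reduced_product (fun i => projT1 (M i)) F.
pose V (p : Prop_var) : Pr := redprod_class F (fun i => projT2 (M i) p).
pose S (a : Pr) := exists t, eval V t = a.
have Sclosed : op_closed S.
  move=> s args /choice[t tE]; exists (App s t) => /=.
  by congr redprod_op; apply/funext => i; exact: tE.
have Sne : exists a, S a by exists (V 0), (Var 0).
pose A := subalgebra Sclosed Sne.
pose v (p : Prop_var) : A := exist S (V p) (ex_intro _ (Var p) erefl).
have svalE t : sval (eval v t) = eval V t.
  by rewrite (@hom_eval _ A Pr (fun a => sval a)).
have sval_inj (a b : A) : sval a = sval b -> a = b.
  by case: a b => a Sa [b Sb]; exact: eq_exist.
exists A, v; split.
- apply: (quasivariety_sub qK).
  by apply: (quasivariety_redprod qK) => i; case: (MP i).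
- by move=> [a [t ta]]; exists t; apply: sval_inj; rewrite svalE.
- move=> e; split=> [/(congr1 sval)|Thetae].
    rewrite !svalE /V !eval_redprod => /(redprod_classP _ _ FF) vMe.
    apply: contrapT => nThetae; have [_ _] := MP (exist _ e nThetae).
    by apply; exact: vMe.
  apply: sval_inj; rewrite !svalE /V !eval_redprod.
  by apply/(redprod_classP _ _ FF) => i; have [_ vTheta _] := MP i; exact: vTheta.
Qed.

Definition theory (L : language) (der : entailment L) (T : set (formula L)) :
  Prop := forall psi, der T psi -> T psi.

Lemma conseq_mono (C : Type) (R : set C -> C -> Prop) (W V : set C) (a : C) :
  consequence_relation R -> V `<=` W -> R V a -> R W a.
Proof.
move=> cR VW; apply: (conseq_cut cR) => x Vx.
by apply: (conseq_refl cR); exact: VW.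
Qed.

Section AlgebraizableTheory.
Variables (L : language) (mu : set (equation L unit)) (Delta : set (term L bool)).
Variables (der : entailment L) (Y : algebra L -> Prop).
Hypotheses (der_conseq : consequence_relation der)
  (alg : algebraizable mu Delta der Y).
Variable T : set (formula L).
Hypothesis thT : theory der T.

(** The Leibniz congruence of T, as a set of equations. *)
Definition Delta_theory : set (equation L Prop_var) :=
  [set e | Delta_eq Delta e `<=` T].

(** If Delta_theory entails e over Y, then T derives Delta(e) in der. *)
Lemma Delta_theory_closed e : eq_conseq Y Delta_theory e -> Delta_theory e.
Proof.
move/(alg_eq alg) => derD psi Dpsi; apply: thT.
apply: conseq_mono (derD _ Dpsi) => //.
by move=> chi [d Td Dchi]; exact: Td.
Qed.

(** Holds because psi and Delta[mu(psi)] are interderivable. *)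
Lemma mu_in_theory psi : mu_form mu psi `<=` Delta_theory <-> T psi.
Proof.
have [toD ofD] := alg_Delta_mu alg psi; split=> [muT|Tpsi].
  apply: thT; apply: conseq_mono ofD => // chi [d mud Dchi].
  exact: muT Dchi.
move=> d mud chi Dchi; apply: thT.
apply: conseq_mono (toD chi _) => //; first by move=> _ ->.
by exists d.
Qed.

End AlgebraizableTheory.

Theorem theorem3p26 (L : language) (der : entailment L)
    (Y : algebra L -> Prop)
    (mu : set (equation L unit)) (Delta : set (term L bool))
    (f : term L unit) (der_s : entailment L) :
  logic der ->
  quasivariety Y ->
  algebraizable mu Delta der Y ->
  selector_term f der Y ->
  PAt_logic f der der_s ->
  forall (Gamma : set (formula L)) (phi : formula L),
    der_s Gamma phi <-> class_sat f mu (QVar f mu Y der_s) Gamma phi.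
Proof.
move=> [der_conseq _] qY alg [_ f_idem] [der' [logic' der_der'] ->] Gamma phi.
have [conseq' subst'] := logic'.
split=> [derGamma A [_ satA]|complete]; first exact: satA.
pose T := [set psi | der' (subst_f f @` Gamma) psi].
have th' psi : der' T psi -> T psi by apply: (conseq_cut conseq').
have thT : theory der T by move=> psi /der_der'; exact: th'.
have [A [v [YA gen vE]]] :=
  term_generated_model qY (Delta_theory_closed der_conseq alg thT).
have muT psi : sat_eqs v (mu_form mu psi) <-> T psi.
  rewrite -(mu_in_theory der_conseq alg thT).
  by split=> H e mue; apply/vE; exact: H.
(* Applies to every regular w, where f o w = w, and to w = f o v, where sigma
   is the identity. *)
have evalE (w : Prop_var -> A) (sigma : Prop_var -> formula L) :
    (forall p, w p = eval1 f (eval v (sigma p))) ->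
    forall chi, sat_eqs w (mu_form mu chi) <-> T (subst sigma (subst_f f chi)).
  move=> wE chi; rewrite -muT; apply: sat_mu_form.
  rewrite !eval_subst; congr (eval _ chi); apply/funext => p.
  by rewrite wE /inst1 eval_subst.
have sat_set (w : Prop_var -> A) (Pi : set (formula L)) :
    sat_eqs w (mu_set mu Pi) <->
    forall chi, Pi chi -> sat_eqs w (mu_form mu chi).
  split=> [H chi Pichi e mue|H e [chi Pichi]]; last exact: H.
  by apply: H; exists chi.
have QA : QVar f mu Y (PAt_variant f der') A.
  split=> // Pi psi derPi w w_reg /sat_set wPi.
  have /choice[sigma sigmaE] p : exists t, eval v t = w p by exact: gen.
  have wE p : w p = eval1 f (eval v (sigma p)) by rewrite sigmaE w_reg.
  apply/(evalE _ _ wE)/th'.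
  apply: conseq_mono (subst' sigma _ _ derPi) => // _ [_ [chi Pichi <-] <-].
  by apply/(evalE _ _ wE)/wPi.
pose w p := eval1 f (v p).
have substVar (chi : formula L) : subst Var chi = chi.
  by elim: chi => [//|s args IH] /=; congr App; apply/funext.
have wE p : w p = eval1 f (eval v (Var p)) by [].
have w_reg : polyatomic_model f w by move=> p; exact: f_idem.
have wGamma : sat_eqs w (mu_set mu Gamma).
  apply/sat_set => chi Gchi; apply/(evalE _ _ wE); rewrite substVar.
  by apply: (conseq_refl conseq'); exists chi.
have /(evalE _ _ wE) := complete A QA w w_reg wGamma.
by rewrite substVar.
Qed.
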